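(* Let $S_1$ be the set of all nonempty partitions of the form $[\ell+1,\ell^k][i,j]$ with integers $\ell\ge 3$, $k>\ell$, $i,j\ge 0$. Then the family of games Rook on $S_1$ is forced and tame but not miserable.
   Context: A partition is a finite weakly decreasing sequence $\lambda=[\lambda_1,\ldots,\lambda_r]$ of positive integers; exponents denote repetition, so $[\ell+1,\ell^k]$ has one part $\ell+1$ and $k$ parts $\ell$; $[\,]$ is the empty partition, and $\mathbb Y^+$ is the set of nonempty partitions. For $i,j\ge 0$, $\lambda[i,j]=[\lambda_{i+1}-j,\lambda_{i+2}-j,\ldots]$ with trailing nonpositive entries removed. For a moveset $M\subseteq \mathbb Z_{\ge0}^2\setminus\{(0,0)\}$ and $\lambda\in\mathbb Y^+$, the impartial chess game $(M,\lambda)$ starts at $\lambda$, and from a position $\mu\in\mathbb Y^+$ a player may move to $\mu[i,j]$ for any $(i,j)\in M$ with $\mu[i,j]\ne[\,]$. The positions of $(M,\lambda)$ are the partitions reachable from $\lambda$ by zero or more moves. A position is terminal if it has no moves. Rook has moveset $\{(k,0):k\ge1\}\cup\{(0,k):k\ge1\}$. The Sprague-Grundy value of a position $p$ is $\mathrm{mex}$ of the Sprague-Grundy values of the positions reachable in one move ($0$ if $p$ is terminal), where $\mathrm{mex}(S)$ is the least nonnegative integer not in $S$. The misère Grundy value is defined by the same mex recursion at non-terminal positions, but terminal positions have value $1$. A position with Sprague-Grundy value $t$ and misère Grundy value $m$ is called a $(t,m)$-position. A game is forced if each move from a $(0,1)$-position results in a $(1,0)$-position and each move from a $(1,0)$-position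 results in a $(0,1)$-position. A game is tame if it has only $(0,1)$-positions, $(1,0)$-positions, and $(k,k)$-positions with $k\ge0$. A game is miserable if for every position $x$ one of the following holds: (i) $x$ is a $(0,1)$-position or a $(1,0)$-position; (ii) there is no move from $x$ to a $(0,1)$-position or a $(1,0)$-position; (iii) there are moves from $x$ to both a $(0,1)$-position and a $(1,0)$-position. For a moveset $M$ and a set $P\subseteq\mathbb Y^+$, the family $(M,P)$ has one of these properties if $(M,\lambda)$ has it for every $\lambda\in P$, and it does not have the property if $(M,\lambda)$ fails it for at least one $\lambda\in P$. *)

(* Defs.v *)
From mathcomp Require Import all_boot zify.

Set Implicit Arguments.
Unset Strict Implicit.
Unset Printing Implicit Defensive.

(* A partition is the sequence of its parts; Yplus is the set of nonempty
   partitions. *)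
Definition is_partition (s : seq nat) : bool := sorted geq s && (0 \notin s).
Definition Yplus (s : seq nat) : bool := is_partition s && (s != [::]).

(* The partition lambda[i, j].  Since a partition is weakly decreasing, the
   entries with x <= j that the filter drops are exactly the trailing ones. *)
Definition trunc (s : seq nat) (i j : nat) : seq nat :=
  [seq x - j | x <- drop i s & j < x].

Record moveset := Moveset {
  moves :> pred (nat * nat);
  moves_neq0 : ~~ moves (0, 0)
}.

Definition rook_moves (ij : nat * nat) : bool :=
  (0 < ij.1) && (ij.2 == 0) || (ij.1 == 0) && (0 < ij.2).

Definition rook : moveset := @Moveset rook_moves isT.

(* The bounds on i and j lose nothing: outside them trunc s i j is empty; see
   optionsP. *)
Definition options (M : moveset) (s : seq nat) : seq (seq nat) :=
  [seq t <- [seq trunc s ij.1 ij.2 |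
               ij <- [seq (i, j) | i <- iota 0 (size s), j <- iota 0 (sumn s)]
               & M ij]
  | t != [::]].

Definition move (M : moveset) : rel (seq nat) := fun s t => t \in options M s.

Definition position (M : moveset) (lam s : seq nat) : Prop :=
  exists2 p, path (move M) lam p & s = last lam p.

Definition mex (s : seq nat) : nat :=
  find (fun n => n \notin s) (iota 0 (size s).+1).

(* size s + sumn s decreases along every move, so it is enough fuel; the
   recursion without fuel is grundyE.  The value of terminal positions is t. *)
Fixpoint grundy_rec (M : moveset) (t fuel : nat) (s : seq nat) : nat :=
  if options M s is [::] then t else
  if fuel is n.+1 then mex [seq grundy_rec M t n u | u <- options M s] else 0.

Definition grundy (M : moveset) (t : nat) (s : seq nat) : nat :=
  grundy_rec M t (size s + sumn s) s.

Definition sprague_grundy (M : moveset) : seq nat -> nat := grundy M 0.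
Definition misere_grundy (M : moveset) : seq nat -> nat := grundy M 1.

Definition is_tm (M : moveset) (t m : nat) (s : seq nat) : Prop :=
  sprague_grundy M s = t /\ misere_grundy M s = m.

Definition forced (M : moveset) (lam : seq nat) : Prop :=
  forall s u, position M lam s -> move M s u ->
    (is_tm M 0 1 s -> is_tm M 1 0 u) /\ (is_tm M 1 0 s -> is_tm M 0 1 u).

Definition tame (M : moveset) (lam : seq nat) : Prop :=
  forall s, position M lam s ->
    [\/ is_tm M 0 1 s, is_tm M 1 0 s | exists k, is_tm M k k s].

Definition miserable (M : moveset) (lam : seq nat) : Prop :=
  forall s, position M lam s ->
    [\/ is_tm M 0 1 s \/ is_tm M 1 0 s,
        ~ (exists2 u, move M s u & is_tm M 0 1 u \/ is_tm M 1 0 u)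
      | (exists2 u, move M s u & is_tm M 0 1 u) /\
        (exists2 u, move M s u & is_tm M 1 0 u)].

Definition family_has (Q : moveset -> seq nat -> Prop)
    (M : moveset) (P : seq nat -> Prop) : Prop :=
  forall lam, P lam -> Q M lam.

Definition family_lacks (Q : moveset -> seq nat -> Prop)
    (M : moveset) (P : seq nat -> Prop) : Prop :=
  exists2 lam, P lam & ~ Q M lam.

Definition S1 (lam : seq nat) : Prop :=
  Yplus lam /\
  exists l k i j, [/\ 3 <= l, l < k & lam = trunc (l.+1 :: nseq k l) i j].

Lemma trunc_nil s i j :
  size s <= i \/ sumn s <= j -> trunc s i j = [::].
Proof.
rewrite /trunc; case=> [le_i|le_j]; first by rewrite drop_oversize.
suff -> : [seq x <- drop i s | j < x] = [::] by [].
apply/eqP; rewrite -[_ == _]negbK -has_filter; apply/hasPn => x /mem_drop sx.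
rewrite -leqNgt; apply: leq_trans le_j.
by elim: s sx => //= y s IH; rewrite inE => /orP[/eqP->|/IH]; lia.
Qed.

Lemma optionsP (M : moveset) s u :
  reflect (exists i j, [/\ M (i, j), u = trunc s i j & u != [::]])
          (u \in options M s).
Proof.
rewrite mem_filter; apply: (iffP andP) => [[nz /mapP[[i j]]]|[i [j [Mij eq_u nz]]]].
  by rewrite mem_filter => /andP[Mij _] /= eq_u; exists i, j.
split=> //; apply/mapP; exists (i, j) => //; rewrite mem_filter Mij /=.
apply/allpairsP; exists (i, j); rewrite !mem_iota !add0n /=; split=> //.
- by rewrite ltnNge; apply: contra nz => ?; rewrite eq_u trunc_nil //; left.
- by rewrite ltnNge; apply: contra nz => ?; rewrite eq_u trunc_nil //; right.
Qed.

Lemma moveP (M : moveset) s u :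
  reflect (exists i j, [/\ M (i, j), u = trunc s i j & u != [::]]) (move M s u).
Proof. exact: optionsP. Qed.

Lemma mexP s : mex s \notin s /\ forall n, n < mex s -> n \in s.
Proof.
have hs : has (fun n => n \notin s) (iota 0 (size s).+1).
  apply/negPn/negP; rewrite has_predC negbK => /allP sub.
  by have := uniq_leq_size (iota_uniq 0 (size s).+1) sub; rewrite size_iota ltnn.
have lt_s : mex s < (size s).+1 by move: hs; rewrite has_find size_iota.
split=> [|n lt_n].
  by have := nth_find 0 hs; rewrite nth_iota.
have := before_find 0 lt_n; rewrite nth_iota ?add0n; last exact: ltn_trans lt_s.
by move/negbFE.
Qed.

Lemma move_decr (M : moveset) s u :
  move M s u -> size u + sumn u < size s + sumn s.
Proof.
case/moveP=> i [j [Mij -> nz]].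
have le_sz r : size [seq x - j | x <- r & j < x] <= size r.
  by rewrite size_map size_filter count_size.
have le_sm r : sumn [seq x - j | x <- r & j < x] <= sumn r.
  by elim: r => //= x r IH; case: ifP => /=; lia.
have sz := le_sz (drop i s); have sm := le_sm (drop i s).
have szd := size_drop i s.
have smd : sumn (drop i s) <= sumn s.
  by rewrite -{2}(cat_take_drop i s) sumn_cat leq_addl.
have s_gt0 : 0 < size s by case: s nz {sz sm szd smd}.
case: (posnP i) => [i0|i_gt0]; last by rewrite /trunc; lia.
case: (posnP j) => [j0|j_gt0].
  by move: Mij (moves_neq0 M); rewrite i0 j0 => ->.
have lt_sm r : [seq x - j | x <- r & j < x] != [::] ->
    sumn [seq x - j | x <- r & j < x] < sumn r.
  elim: r => //= x r IH; case: ifP => /= [jx _|_ /IH]; last lia.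
  by have := le_sm r; lia.
by have := lt_sm _ nz; rewrite /trunc; lia.
Qed.

Lemma grundyE (M : moveset) t s :
  grundy M t s =
    if options M s is [::] then t else mex [seq grundy M t u | u <- options M s].
Proof.
suff E n r : size r + sumn r <= n -> grundy_rec M t n r =
    if options M r is [::] then t
    else mex [seq grundy_rec M t (size u + sumn u) u | u <- options M r].
  exact: E.
elim/ltn_ind: n r => -[|n] IH r le_n.
  rewrite /=; case E: (options M r) => [//|u o].
  have : move M r u by rewrite /move E mem_head.
  by move/move_decr; lia.
rewrite /=; have : {in options M r, forall u,
    grundy_rec M t n u = grundy_rec M t (size u + sumn u) u}.
  move=> u ru; have lt_u := @move_decr M r u ru.
  rewrite IH //; last lia.
  by rewrite [RHS]IH //; lia.
by move/eq_in_map => ->.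
Qed.

(* Main.v *)
Require Import Defs.
From mathcomp Require Import all_boot zify.

Set Implicit Arguments.
Unset Strict Implicit.
Unset Printing Implicit Defensive.

(* Every position of Rook on [l + 1, l^k] is a rectangle [(x + 1)^(y + 1)],
   which plays as two-heap Nim on (x, y), or a hook
   [x + 2, (x + 1)^(y + 1)] with x < y.  A rectangle with x, y <= 1 is a
   (0, 1)- or a (1, 0)-position, and these rectangles form a forced game.  All
   other positions are (k, k)-positions: the values of their options agree in
   the two conventions, or agree up to the exchange of 0 and 1 while both 0 and
   1 occur.  A hook reaches 0 and 1 because its rectangles (x, x) and
   (x, x xor 1) have these Nim values.  For x = 2 every rectangle (x, y) is a
   (k, k)-position, so the hook with (x, y) = (2, 3) moves to the
   (0, 1)-position [1] but to no (1, 0)-position; the family is not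
   miserable. *)

(** * Grundy values *)

Lemma grundyP (M : moveset) t s : (exists u, move M s u) ->
  grundy M t s = mex [seq grundy M t u | u <- options M s].
Proof. by case=> u; rewrite grundyE /move; case: (options M s). Qed.

Lemma grundy_neq (M : moveset) t s u :
  move M s u -> grundy M t u <> grundy M t s.
Proof.
move=> su; rewrite (grundyP t (s := s)); last by exists u.
move=> eq_u; have [/negP[]] := mexP [seq grundy M t u | u <- options M s].
by rewrite -eq_u; apply: map_f.
Qed.

Lemma grundy_gt (M : moveset) t s n : (exists u, move M s u) ->
  n < grundy M t s -> exists2 u, move M s u & grundy M t u = n.
Proof.
move=> nt; rewrite (grundyP t nt) => lt_n.
by have [_ /(_ n lt_n) /mapP[u su ->]] := mexP [seq grundy M t u | u <- options M s];
  exists u.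
Qed.

(** The mex recursion without lists. A value below [v] would be shared by an option, and a value
    above [v] would make [v] the value of an option. *)
Lemma grundy_eq (M : moveset) t s v : (exists u, move M s u) ->
    (forall u, move M s u -> grundy M t u <> v) ->
    (forall n, n < v -> exists2 u, move M s u & grundy M t u = n) ->
  grundy M t s = v.
Proof.
move=> nt nv lt_v; case: (ltngtP (grundy M t s) v) => //.
  by move=> /lt_v[u /grundy_neq ne_u /ne_u].
by move=> /(grundy_gt nt)[u /nv].
Qed.

Definition tame_position (M : moveset) (s : seq nat) : Prop :=
  [\/ is_tm M 0 1 s, is_tm M 1 0 s | exists k, is_tm M k k s].

Lemma diagonal_tame (M : moveset) s :
  grundy M 0 s = grundy M 1 s -> tame_position M s.
Proof. by move=> eq_s; constructor 3; exists (grundy M 0 s). Qed.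

Lemma diagonal_not01 (M : moveset) s : grundy M 0 s = grundy M 1 s ->
  ~ is_tm M 0 1 s /\ ~ is_tm M 1 0 s.
Proof.
by rewrite /is_tm /sprague_grundy /misere_grundy => ->; split; case=> ->.
Qed.

Lemma diagonal_options (M : moveset) s : (exists u, move M s u) ->
    (forall u, move M s u -> grundy M 0 u = grundy M 1 u) ->
  grundy M 0 s = grundy M 1 s.
Proof.
move=> nt eq_u; apply: grundy_eq => // [u su|n /(grundy_gt nt)[u su <-]].
  by rewrite eq_u //; exact: grundy_neq.
by exists u => //; rewrite eq_u.
Qed.

(** Exchanging 0 and 1 on some options leaves the set of option values unchanged when both already
    occur in each convention; all other option values coincide by tameness. *)
Lemma diagonal_tame_options (M : moveset) s :
    (forall u, move M s u -> tame_position M u) ->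
    (forall t n, t < 2 -> n < 2 -> exists2 u, move M s u & grundy M t u = n) ->
  grundy M 0 s = grundy M 1 s.
Proof.
move=> tame_s small_s.
have nt : exists u, move M s u by have [u su _] := small_s 0 0 isT isT; exists u.
apply: grundy_eq => // [u su eq_u|n /(grundy_gt nt)[u su eq_u]].
  (* Some option has misère value 0 and another has 1, so the misère value of [s] is neither. *)
  have ge2 n : n < 2 -> n <> grundy M 1 s.
    by case/(small_s 1 n isT)=> w /grundy_neq sw <-; exact: sw.
  have := tame_s u su; rewrite /tame_position /is_tm.
  rewrite /sprague_grundy /misere_grundy eq_u.
  case=> [[E _]|[E _]|[k [E1 E2]]]; [exact: (ge2 0)|exact: (ge2 1)|].
  by apply: (@grundy_neq _ 1 _ _ su); rewrite E2.
case: (ltnP n 2) => [/(small_s 0 n isT)//|n_ge2].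
exists u => //; have := tame_s u su; rewrite /tame_position /is_tm.
rewrite /sprague_grundy /misere_grundy eq_u.
by case=> [[_ E]|[_ E]|[k [E1 E2]]]; lia.
Qed.

(** * Rectangles and hooks *)

(** The shift by one makes [x] and [y] the numbers of columns and rows that can still be removed, as
    a move may not reach the empty partition. *)
Definition rect x y : seq nat := nseq y.+1 x.+1.
Definition hook x y : seq nat := x.+2 :: nseq y.+1 x.+1.

Lemma trunc_nseq a b i j :
  trunc (nseq b a) i j = if j < a then nseq (b - i) (a - j) else [::].
Proof.
rewrite /trunc drop_nseq; case: ifP => ja.
  by rewrite filter_nseq ja mul1n map_nseq.
by rewrite filter_nseq ja.
Qed.

Lemma trunc_hook0 a b j :
  trunc (a.+1 :: nseq b a) 0 j =
    if j <= a then (a.+1 - j) :: trunc (nseq b a) 0 j else [::].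
Proof.
rewrite /trunc !drop0 /= ltnS; case: ifP => [//|ja].
by rewrite filter_nseq (_ : j < a = false) //; lia.
Qed.

Lemma trunc_hookS a b i j :
  trunc (a.+1 :: nseq b a) i.+1 j = trunc (nseq b a) i j.
Proof. by []. Qed.

Lemma rook_rectP x y u :
  move rook (rect x y) u <->
    (exists2 x', x' < x & u = rect x' y) \/ (exists2 y', y' < y & u = rect x y').
Proof.
split=> [/moveP[i [j [/= Mij -> nz]]]|].
  move: nz; rewrite trunc_nseq; case: ifP => // jx nz.
  have iy : i < y.+1 by rewrite -subn_gt0; case: (y.+1 - i) nz.
  case/orP: Mij => /andP[]; rewrite /= => i0 j0.
    by right; exists (y - i); [lia | rewrite /rect; congr nseq; lia].
  by left; exists (x - j); [lia | rewrite /rect; congr nseq; lia].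
case=> -[z lt_z ->]; apply/moveP.
  exists 0, (x - z); split=> //; first by rewrite /= /rook_moves /=; lia.
  by rewrite trunc_nseq ifT; [rewrite /rect; congr nseq; lia | lia].
exists (y - z), 0; split=> //; first by rewrite /= /rook_moves /=; lia.
by rewrite trunc_nseq /= /rect; congr nseq; lia.
Qed.

(** Removing at most [x] columns keeps the hook shape, and removing [x + 1] leaves only the last
    cell of the long row. Removing rows takes the long row first, so [y' = y] is possible. *)
Lemma rook_hookP x y u :
  move rook (hook x y) u <->
    [\/ exists2 x', x' < x & u = hook x' y, u = rect 0 0
      | exists2 y', y' <= y & u = rect x y'].
Proof.
split=> [/moveP[i [j [/= Mij -> nz]]]|].
  case: i nz Mij => [|i]; rewrite ?trunc_hook0 ?trunc_hookS => nz Mij.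
    have {Mij} j0 : 0 < j by move: Mij; rewrite /rook_moves /=.
    move: nz; case: ifP => // jx _; rewrite trunc_nseq; case: ifP => jx'.
      constructor 1; exists (x - j); first lia.
      by rewrite /hook subn0; congr (_ :: nseq _ _); lia.
    by constructor 2; rewrite /rect /=; congr (_ :: _); lia.
  have {Mij} j0 : j = 0 by move: Mij; rewrite /rook_moves /=; lia.
  move: nz; rewrite j0 trunc_nseq /= => nz.
  have iy : i < y.+1 by rewrite -subn_gt0; case: (y.+1 - i) nz.
  by constructor 3; exists (y - i); [lia | rewrite /rect; congr nseq; lia].
case=> [[z lt_z ->]|->|[z le_z ->]]; apply/moveP.
- exists 0, (x - z); split=> //; first by rewrite /= /rook_moves /=; lia.
  rewrite trunc_hook0 trunc_nseq !ifT /hook; try lia.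
  by rewrite subn0; congr (_ :: nseq _ _); lia.
- exists 0, x.+1; split=> //; rewrite trunc_hook0 trunc_nseq ltnn leqnn.
  by rewrite /rect /=; congr (_ :: _); lia.
exists (y - z).+1, 0; split=> //.
by rewrite trunc_hookS trunc_nseq ltn0Sn /rect; congr nseq; lia.
Qed.

(** * Values of rectangles in both conventions *)

Notation g := (grundy rook).

Lemma rook_rectl x y x' : x' < x -> move rook (rect x y) (rect x' y).
Proof. by move=> lt_x; apply/rook_rectP; left; exists x'. Qed.

Lemma rook_rectr x y y' : y' < y -> move rook (rect x y) (rect x y').
Proof. by move=> lt_y; apply/rook_rectP; right; exists y'. Qed.

Lemma rect_nonterminal x y : 0 < x + y -> exists u, move rook (rect x y) u.
Proof.
case: x => [|x] xy; first by exists (rect 0 0); apply: rook_rectr.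
by exists (rect 0 y); apply: rook_rectl.
Qed.

(** Transposition exchanges row moves and column moves. *)
Lemma grundy_rectC t x y : g t (rect x y) = g t (rect y x).
Proof.
have [n le_n] := ubnP (x + y); elim: n x y le_n => // n IH x y le_n.
case: (posnP (x + y)) => [/eqP|xy0].
  by rewrite addn_eq0 => /andP[/eqP-> /eqP->].
have yx0 : 0 < y + x by rewrite addnC.
apply: grundy_eq => [|u /rook_rectP[] [z lt_z ->]|v].
- exact: rect_nonterminal.
- by rewrite IH; [apply: grundy_neq; apply: rook_rectr | lia].
- by rewrite IH; [apply: grundy_neq; apply: rook_rectl | lia].
case/(grundy_gt (rect_nonterminal yx0)) => u /rook_rectP[] [z lt_z ->] <-.
  by exists (rect x z); [apply: rook_rectr | rewrite IH; last lia].
by exists (rect z y); [apply: rook_rectl | rewrite IH; last lia].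
Qed.

(** Each option of a square can be answered by restoring a smaller square, so it has nonzero
    value. *)
Lemma grundy_rect_diag x : g 0 (rect x x) = 0.
Proof.
elim/ltn_ind: x => -[|x] IH; first by vm_compute.
apply: grundy_eq => // [|u]; first exact: rect_nonterminal.
case/rook_rectP=> -[z lt_z ->]; rewrite -[X in _ <> X](IH z lt_z);
  apply/nesym/grundy_neq; [exact: rook_rectr | exact: rook_rectl].
Qed.

Lemma grundy_rect_double i : g 0 (rect i.*2 i.*2.+1) = 1.
Proof.
elim/ltn_ind: i => i IH.
have opt0 : move rook (rect i.*2 i.*2.+1) (rect i.*2 i.*2) by exact: rook_rectr.
(* The partner [z'] is z xor 1, which stays below 2i. An option with a side [z] below 2i can thus
   move to value 1 and does not have value 1 itself. *)
have pair z : z < i.*2 -> exists2 z', z' < i.*2 & g 0 (rect z z') = 1.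
  move=> lt_z; have := odd_double_half z; case: (odd z) => /= <-.
    by exists z./2.*2; [lia | rewrite grundy_rectC add1n IH //; lia].
  by exists z./2.*2.+1; [lia | rewrite add0n IH //; lia].
apply: grundy_eq => [|u|[|//] _]; first by exists (rect i.*2 i.*2).
  case/rook_rectP=> -[z lt_z ->].
    have [z' lt_z' <-] := pair z lt_z.
    by apply/nesym/grundy_neq/rook_rectr; lia.
  case: (ltnP z i.*2) => [/pair[z' lt_z' <-]|le_z].
    by rewrite [X in _ <> X]grundy_rectC; apply/nesym/grundy_neq/rook_rectl.
  have -> : z = i.*2 by lia.
  by rewrite grundy_rect_diag.
by exists (rect i.*2 i.*2) => //; exact: grundy_rect_diag.
Qed.

Lemma small_rect x y : x < 2 -> y < 2 ->
  is_tm rook (x != y) (x == y) (rect x y).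
Proof. by case: x y => [|[|]] // [|[|]] //; split; vm_compute. Qed.

Lemma small_rect_tame x y : x < 2 -> y < 2 -> tame_position rook (rect x y).
Proof.
move=> lt_x lt_y; have := small_rect lt_x lt_y.
by case: (x == y) => ?; [constructor 1 | constructor 2].
Qed.

(** Induction on [x + y], with [y <= x] by symmetry. If [y <= 1], the options (0, y) and (1, y)
    supply 0 and 1 in each convention. Otherwise every option keeps a side above 1 and is diagonal
    by induction. *)
Lemma grundy_rect_large x y : 1 < maxn x y ->
  g 0 (rect x y) = g 1 (rect x y).
Proof.
have [n le_n] := ubnP (x + y); elim: n x y le_n => // n IH x y le_n.
wlog le_yx : x y le_n / y <= x.
  move=> W; case/orP: (leq_total y x) => [le_yx|le_xy]; first exact: W.
  by rewrite maxnC (grundy_rectC 0) (grundy_rectC 1); apply: W; rewrite 1?addnC.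
rewrite (maxn_idPl le_yx) => x_gt1.
have rect_tame x' y' : x' + y' < x + y -> tame_position rook (rect x' y').
  move=> lt_xy; case: (ltnP 1 (maxn x' y')) => [lt1|le1].
    by apply/diagonal_tame/IH => //; lia.
  by apply: small_rect_tame; lia.
case: (ltnP 1 y) => y1; last first.
  apply: diagonal_tame_options => [u /rook_rectP[] [z lt_z ->]|t v t2 v2].
  - by apply: rect_tame; rewrite ltn_add2r.
  - by apply: rect_tame; rewrite ltn_add2l.
  have sm z : z < 2 -> is_tm rook (z != y) (z == y) (rect z y).
    by move=> ?; apply: small_rect.
  have [z z2 <-] : exists2 z, z < 2 & g t (rect z y) = v.
    have [E00 E01] := sm 0 isT; have [E10 E11] := sm 1 isT.
    move: E00 E01 E10 E11; rewrite /sprague_grundy /misere_grundy.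
    case: t t2 => [|[|]] // _; case: v v2 => [|[|]] // _;
    case: y y1 {le_yx le_n rect_tame sm} => [|[|]] // _ E1 E2 E3 E4;
    by [exists 0 | exists 1].
  by exists (rect z y) => //; apply: rook_rectl; lia.
apply: diagonal_options => [|u /rook_rectP[] [z lt_z ->]].
- by apply: rect_nonterminal; lia.
- by apply: IH; lia.
by apply: IH; lia.
Qed.

Lemma rect_tame x y : tame_position rook (rect x y).
Proof.
case: (ltnP 1 (maxn x y)) => [/grundy_rect_large/diagonal_tame //|le1].
by apply: small_rect_tame; lia.
Qed.

(** * Values of hooks *)

Lemma hook_small_values x y t v : x < y -> t < 2 -> v < 2 ->
  exists2 y', y' <= y & g t (rect x y') = v.
Proof.
move=> xy t2 v2; case: (ltnP x 2) => x2.
  have [E00 E01] := @small_rect x 0 x2 isT.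
  have [E10 E11] := @small_rect x 1 x2 isT.
  move: E00 E01 E10 E11; rewrite /sprague_grundy /misere_grundy.
  case: t t2 => [|[|]] // _; case: v v2 => [|[|]] // _;
  case: x x2 xy => [|[|]] // _ xy E1 E2 E3 E4;
  by [exists 0 | exists 1 => //; lia].
have eq_t y' : g t (rect x y') = g 0 (rect x y').
  case: t t2 => [|[|]] // _; rewrite grundy_rect_large //; lia.
case: v v2 => [|[|]] // _.
  by exists x; [exact: ltnW | rewrite eq_t grundy_rect_diag].
(* Value 1 is found at x xor 1: this is x - 1 for odd x, and x + 1 for even x, which is at most [y]
   because [x < y]. *)
have := odd_double_half x; case: (odd x) => /= eq_x.
  exists x./2.*2; first lia.
  by rewrite eq_t grundy_rectC -{2}eq_x add1n grundy_rect_double.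
exists x./2.*2.+1; first lia.
by rewrite eq_t -{1}eq_x add0n grundy_rect_double.
Qed.

Lemma grundy_hook x y : x < y -> g 0 (hook x y) = g 1 (hook x y).
Proof.
elim/ltn_ind: x => x IH xy; apply: diagonal_tame_options => [u|t v t2 v2].
  case/rook_hookP=> [[z lt_z ->]|->|[z _ ->]]; try exact: rect_tame.
  by apply/diagonal_tame/IH => //; lia.
have [y' le_y' <-] := hook_small_values xy t2 v2.
by exists (rect x y') => //; apply/rook_hookP; constructor 3; exists y'.
Qed.

(** * The family S1 *)

Definition rect_or_hook (s : seq nat) : Prop :=
  (exists x y, s = rect x y) \/ (exists2 xy, xy.1 < xy.2 & s = hook xy.1 xy.2).

(** The inequality between the sides of a hook survives, since a move to another hook lowers [x] and
    keeps [y]. *)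
Lemma rect_or_hook_move s u :
  rect_or_hook s -> move rook s u -> rect_or_hook u.
Proof.
case=> [[x [y ->]] /rook_rectP[] [z _ ->]|[[x y] /= xy ->]].
- by left; exists z, y.
- by left; exists x, z.
case/rook_hookP=> [[z lt_z ->]|->|[z _ ->]].
- by right; exists (z, y) => //=; apply: ltn_trans xy.
- by left; exists 0, 0.
by left; exists x, z.
Qed.

Lemma rect_or_hook_S1 lam : S1 lam -> rect_or_hook lam.
Proof.
case=> /andP[_ nz] [l [k [i [j [l3 lk eq_lam]]]]]; move: nz.
have rectE i' : trunc (nseq k l) i' j != [::] ->
    rect_or_hook (trunc (nseq k l) i' j).
  rewrite trunc_nseq; case: ifP => // jl nz; left.
  have ik : i' < k by rewrite -subn_gt0; case: (k - i') nz.
  by exists (l - j).-1, (k - i').-1; rewrite /rect; congr nseq; lia.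
rewrite eq_lam; case: i {eq_lam} => [|i]; last exact: rectE.
rewrite trunc_hook0.
case: ifP => // le_j _; rewrite trunc_nseq; case: ifP => lt_j; last first.
  by left; exists 0, 0; rewrite /rect /=; congr (_ :: _); lia.
(* The hypothesis [l < k] gives the inequality between the sides. *)
right; exists ((l - j).-1, k.-1) => /=; first lia.
by rewrite /hook subn0; congr (_ :: nseq _ _); lia.
Qed.

Lemma rect_or_hook_position lam s :
  S1 lam -> position rook lam s -> rect_or_hook s.
Proof.
move=> /rect_or_hook_S1 + [p + ->]; elim: p lam => //= u p IH lam lamP.
by case/andP=> /(rect_or_hook_move lamP); exact: IH.
Qed.

Lemma rect_or_hook_tame s : rect_or_hook s -> tame_position rook s.
Proof.
case=> [[x [y ->]]|[[x y] /= xy ->]]; first exact: rect_tame.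
exact/diagonal_tame/grundy_hook.
Qed.

(** * Forcedness, and a position violating miserability *)

Lemma rect_or_hook_01 s : rect_or_hook s ->
  is_tm rook 0 1 s \/ is_tm rook 1 0 s ->
  exists x y, [/\ x < 2, y < 2 & s = rect x y].
Proof.
case=> [[x [y ->]]|[[x y] /= xy ->]] s01; last first.
  by have [] := diagonal_not01 (grundy_hook xy); case: s01.
exists x, y; case: (ltnP 1 (maxn x y)) => [lt1|le1]; last by split=> //; lia.
by have [] := diagonal_not01 (grundy_rect_large lt1); case: s01.
Qed.

Lemma small_rect_forced x y u : x < 2 -> y < 2 -> move rook (rect x y) u ->
  (is_tm rook 0 1 (rect x y) -> is_tm rook 1 0 u) /\
  (is_tm rook 1 0 (rect x y) -> is_tm rook 0 1 u).
Proof.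
move=> x2 y2 xyu; have [E0 E1] := small_rect x2 y2.
rewrite {1 3}/is_tm E0 E1.
(* A move changes exactly one coordinate in {0, 1}, so it flips whether the two are equal. *)
have [x' [y' [x2' y2' eq_u ne]]] : exists x' y',
    [/\ x' < 2, y' < 2, u = rect x' y' & (x' == y') = (x != y)].
  case/rook_rectP: xyu => -[z lt_z ->]; [exists z, y | exists x, z];
    by split=> //; lia.
have := small_rect x2' y2'; rewrite eq_u ne negbK.
by case: (x == y) => uP; split=> // -[].
Qed.

Lemma hook_not_miserable : ~ miserable rook (hook 2 3).
Proof.
move=> mis; have h23 : position rook (hook 2 3) (hook 2 3) by exists [::].
have [no01 no10] := diagonal_not01 (@grundy_hook 2 3 isT).
case: (mis _ h23) => [[]// |[]|[_ [u]]].
  exists (rect 0 0); first by apply/rook_hookP; constructor 2.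
  by left; apply: (@small_rect 0 0).
case/rook_hookP=> [[z lt_z ->]|->|[z _ ->]].
(* No option is a (1, 0)-position: narrower hooks are diagonal, [1] has normal value 0, and
   rectangles with first side 2 are diagonal. *)
- by have [] := diagonal_not01 (@grundy_hook z 3 (ltnW lt_z)).
- by case: (@small_rect 0 0 isT isT) => E _; case; rewrite E.
by have [] := diagonal_not01 (@grundy_rect_large 2 z (leq_maxl 2 z)).
Qed.

Theorem theorem4p12 :
  family_has forced rook S1 /\ family_has tame rook S1 /\
  family_lacks miserable rook S1.
Proof.
split; [|split].
- move=> lam lamP s u /(rect_or_hook_position lamP) sP su.
  split=> s01; have [|x [y [x2 y2 eq_s]]] := rect_or_hook_01 sP;
    by [left | right | move: su s01; rewrite eq_s => /(small_rect_forced x2 y2)[]].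
- by move=> lam lamP s /(rect_or_hook_position lamP)/rect_or_hook_tame.
exists (hook 2 3); last exact: hook_not_miserable.
(* This hook is [4, 3^4], the untruncated partition with the least admissible [l] and [k]. *)
by split=> //; exists 3, 4, 0, 0.
Qed.
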